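(* Let $A$ and $B$ be independent nonnegative random variables, let $X=B-A$ with $\mathbb{P}[X<0]>0$, and let $W$ be the steady-state limit of the recursion $W_{n+1}=\max\{0,X_{n+1}-W_n\}$. Let $\kappa\in[0,\infty)$ and suppose that $e^B$ is regularly varying with index $-\kappa$. Then, as $x\to\infty$, $$\mathbb{P}[W>x]\sim\mathbb{P}[X>x]\;\mathbb{E}[e^{-\kappa W}].$$
   Context: Let $\{A_n\}$ and $\{B_n\}$ be two mutually independent sequences of i.i.d. nonnegative random variables distributed as $A$ and $B$ respectively, $X_{n+1}=B_{n+1}-A_n$ for $n\geqslant 1$, and $W_{n+1}=\max\{0,X_{n+1}-W_n\}$, with $W_1\geqslant 0$ independent of $\{X_n\}_{n\geqslant 2}$. Since $\mathbb{P}[X<0]>0$, the law of $W_n$ converges, irrespective of the initial state, to a unique limiting distribution; $W$ is a random variable with this distribution, and, with $W$ independent of $X$, it satisfies $W\stackrel{\mathcal{D}}{=}\max\{0,X-W\}$ (equality in distribution). ''$e^B$ is regularly varying with index $-\kappa$'' means that $\mathbb{P}[B>x]>0$ for all $x$ and, for every real $y$, $\mathbb{P}[B>x+y]/\mathbb{P}[B>x]\to e^{-\kappa y}$ as $x\to\infty$. The notation $f(x)\sim g(x)$ means $f(x)/g(x)\to 1$ as $x\to\infty$. *)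

(* Defs.v *)
From mathcomp Require Import all_boot all_order all_algebra finmap.
From mathcomp Require Import all_classical all_reals all_analysis measurable_realfun.

Set Implicit Arguments.
Unset Strict Implicit.
Unset Printing Implicit Defensive.

Import Order.TTheory GRing.Theory Num.Theory.
Import numFieldNormedType.Exports.

Local Open Scope classical_set_scope.
Local Open Scope ring_scope.

Definition sub_rv (R : realType)
    (d : measure_display) (T : measurableType d) (P : probability T R)
    (Y Z : {RV P >-> R}) : {RV P >-> R} := ((Y : {mfun T >-> R}) - Z)%R.

(* [distribution] is a pushforward defined on every subset of R; only its
   values on the measurable sets are the law of the variable. *)
Definition same_law (R : realType)
    (d1 : measure_display) (T1 : measurableType d1) (P1 : probability T1 R)
    (d2 : measure_display) (T2 : measurableType d2) (P2 : probability T2 R)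
    (Y : {RV P1 >-> R}) (Z : {RV P2 >-> R}) : Prop :=
  forall D : set R, measurable D -> distribution P1 Y D = distribution P2 Z D.

Definition mutually_independent (R : realType)
    (d : measure_display) (T : measurableType d) (P : probability T R)
    (I : choiceType) (Y : I -> {RV P >-> R}) : Prop :=
  forall (J : {fset I}) (D : I -> set R),
    (forall i, i \in J -> measurable (D i)) ->
    P (\bigcap_(i in [set` J]) (Y i @^-1` D i)) =
    (\prod_(i <- J) P (Y i @^-1` D i))%E.

Definition sigma_of_family (R : realType)
    (d : measure_display) (T : measurableType d) (P : probability T R)
    (I : Type) (Y : I -> {RV P >-> R}) : set_system T :=
  <<s \bigcup_i preimage_set_system setT (Y i) measurable >>.

Definition independent_systems (R : realType)
    (d : measure_display) (T : measurableType d) (P : probability T R)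
    (F G : set_system T) : Prop :=
  forall E H : set T, F E -> G H -> P (E `&` H) = (P E * P H)%E.

Definition independent_of_family (R : realType)
    (d : measure_display) (T : measurableType d) (P : probability T R)
    (Z : {RV P >-> R}) (I : Type) (Y : I -> {RV P >-> R}) : Prop :=
  independent_systems P (sigma_of_family (fun _ : unit => Z))
                        (sigma_of_family Y).

Definition independent_rv (R : realType)
    (d : measure_display) (T : measurableType d) (P : probability T R)
    (Y Z : {RV P >-> R}) : Prop :=
  independent_systems P (sigma_of_family (fun _ : unit => Y))
                        (sigma_of_family (fun _ : unit => Z)).

(* Independence of the family [join_seq u v] means that the terms of each
   sequence are independent and that the two sequences are independent of
   each other. *)
Definition join_seq (S : Type) (u v : nat -> S) (i : nat + nat) : S :=
  match i with inl n => u n | inr n => v n end.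

(* The variables of the sequence and the limit may live on different
   probability spaces. *)
Definition cvg_in_law (R : realType)
    (d1 : measure_display) (T1 : measurableType d1) (P1 : probability T1 R)
    (d2 : measure_display) (T2 : measurableType d2) (P2 : probability T2 R)
    (Y : nat -> {RV P1 >-> R}) (Z : {RV P2 >-> R}) : Prop :=
  forall r : R, {for r, continuous (cdf Z)} ->
    (fun n => cdf (Y n) r) @ \oo --> cdf Z r.

(* P[Y > x] as a real number *)
Definition tail (R : realType)
    (d : measure_display) (T : measurableType d) (P : probability T R)
    (Y : {RV P >-> R}) (x : R) : R := fine (ccdf Y x).

(* Regular variation, with index -kappa, of t |-> P[e^Y > t], read through
   t = e^x. *)
Definition exp_regularly_varying (R : realType)
    (d : measure_display) (T : measurableType d) (P : probability T R)
    (Y : {RV P >-> R}) (kappa : R) : Prop :=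
  (forall x : R, 0 < tail Y x) /\
  (forall y : R, tail Y (x + y) / tail Y x @[x --> +oo] --> expR (- kappa * y)).

(* As x^-1 = 0 for x = 0, the limit 1 forces f and g to be eventually nonzero. *)
Definition asymp_equiv (R : realType) (f g : R -> R) : Prop :=
  f x / g x @[x --> +oo] --> (1 : R).

(* Main.v *)
Require Import Defs.
From mathcomp Require Import all_boot all_order all_algebra finmap.
From mathcomp Require Import all_classical all_reals all_analysis measurable_realfun.
From mathcomp Require Import ring.

Set Implicit Arguments.
Unset Strict Implicit.
Unset Printing Implicit Defensive.

Import Order.TTheory GRing.Theory Num.Theory.
Import numFieldNormedType.Exports.

Local Open Scope classical_set_scope.
Local Open Scope ring_scope.

(** Write g for the tail of a law nu and mu for a law carried by [0, +oo[.
    If V has law mu, U has law nu and they are independent, conditioning on V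
    gives P[U - V > x] = E[g (x + V)].  When g (x + y) / g x tends to
    expR (- kappa * y), the quotients g (x + V) / g x lie in [0, 1] because g
    is nonincreasing and V >= 0, so dominated convergence yields
    P[U - V > x] / g x --> E[expR (- kappa * V)]  ([exp_rv_mixture]).

    This is used twice.  With U = B and V = A it gives
    P[X > x] ~ P[B > x] E[expR (- kappa * A)]; the constant being positive, the
    tail of X inherits the regular variation of that of B
    ([rv_asymp_transfer]).  With U = X and V = W it gives the theorem, provided
    that P[W > x] = P[X - W > x] for x >= 0 when X and W are independent.

    That fixed-point identity is where the recursion enters
    ([limit_law_fixpoint]).  Put X_n = B_(n+1) - A_n, the increment that turns
    W_n into W_(n+1); then P[W_(n+1) > x] = P[X_n - W_n > x] for x >= 0, with
    independent terms on the right.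
    The tail of X may jump, so weak convergence of the laws of W_n cannot be
    inserted directly; instead the laws of open rays are lower semicontinuous
    along the sequence ([cvg_in_law_lt], [cvg_in_law_gt]), Fatou's lemma
    transfers this to the open half-planes u - w > x and u - w < x under the
    product law ([cvg_in_law_product]), and the two resulting one-sided bounds
    at the continuity points of the limit, which are dense, meet by right
    continuity.

    The independence of W_n and X_n is obtained by induction on n: W_n is
    independent of the whole vector of increments from X_n on, the increments being
    mutually independent as functions of disjoint blocks of the two input
    sequences ([increments_indep], [state_indep_future]). *)

(** * Regularly varying tails and mixtures *)

(** If the integral vanished, f would be zero off a null set, and a null set is not
    the whole of a probability space. *)
Lemma prob_integral_gt0 (R : realType) (d : measure_display)
    (T : measurableType d) (P : probability T R) (f : T -> R) :
  measurable_fun setT f -> (forall t, 0 < f t) ->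
  (0 < \int[P]_t (f t)%:E)%E.
Proof.
move=> mf f0.
have mEf : measurable_fun setT (fun t => (f t)%:E) by exact/measurable_EFinP.
rewrite lt0e integral_ge0 ?andbT; last by move=> t _; rewrite lee_fin ltW.
apply/eqP => int0.
have : (\int[P]_(t in setT) `|(f t)%:E| = 0)%E.
  rewrite -int0; apply: eq_integral => t _.
  by rewrite gee0_abs// lee_fin ltW.
move/(ae_eq_integral_abs P measurableT mEf) => [N [mN N0 sub]].
have NT : N = setT.
  apply/seteqP; split => // t _; apply: sub => /= /(_ I) [] ft0.
  by have := f0 t; rewrite ft0 ltxx.
by have /eqP := probability_setT P; rewrite -NT N0 eq_sym onee_eq0.
Qed.

(** Both sides are 0 when a is infinite, which spares a finiteness proof for the
    mixtures below. *)
Lemma fineMr_ge0 (R : realType) (a : \bar R) (c : R) :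
  (0 <= a)%E -> 0 < c -> fine (a * c%:E)%E = fine a * c.
Proof.
by move=> a0 c0; case: a a0 => [r| |]//= _; rewrite gt0_mulye ?lte_fin//= mul0r.
Qed.

Section mixture.
Variables (R : realType) (g : R -> R) (kappa : R) (mu : probability R R).
Hypothesis g_dec : {homo g : x y /~ x <= y}.
Hypothesis g_gt0 : forall x, 0 < g x.
Hypothesis g_rv : forall y, g (x + y) / g x @[x --> +oo] --> expR (- kappa * y).
Hypothesis mu_ge0 : mu `]-oo, 0[%classic = 0%E.

Lemma nonincreasing_shift_measurable x : measurable_fun setT (fun w : R => g (x + w)).
Proof.
apply: nonincreasing_measurable => // a b ab.
by apply: g_dec; rewrite lerD2l.
Qed.

(** Dominated convergence along a sequence of thresholds: the quotients are at
    most 1 outside the null set of negative w, by monotonicity of g. *)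
Let dct (u : R^nat) : u n @[n --> \oo] --> +oo ->
  mu.-integrable setT (fun w => (expR (- kappa * w))%:E) /\
  (\int[mu]_w (g (u n + w) / g (u n))%:E @[n --> \oo] -->
   \int[mu]_w (expR (- kappa * w))%:E)%E.
Proof.
move=> uoo.
have [] := @dominated_convergence _ _ _ mu setT measurableT
  (fun n w => (g (u n + w) / g (u n))%:E)
  (fun w => (expR (- kappa * w))%:E) (cst 1%E).
- move=> n; apply/measurable_EFinP; apply: measurable_funM => //.
  exact: nonincreasing_shift_measurable.
- apply/measurable_EFinP.
  exact: (measurableT_comp (@measurable_expR R) (@mulrl_measurable _ _ _)).
- apply: aeW => w _; apply: cvg_EFin; first by near=> n.
  exact: (cvg_comp _ _ uoo (@g_rv w)).
- exact: finite_measure_integrable_cst.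
- exists `]-oo, 0[%classic; split => //= w /= wN.
  rewrite in_itv/= ltNge; apply/negP => w0; apply: wN => n _.
  have q0 : 0 <= g (u n + w) / g (u n) by rewrite ltW// divr_gt0.
  rewrite lee_fin ger0_norm//.
  by rewrite ler_pdivrMr// mul1r; apply: g_dec; rewrite lerDl.
by move=> ? _.
Unshelve. all: by end_near. Qed.

Lemma integrable_expR_mixture :
  mu.-integrable setT (fun w => (expR (- kappa * w))%:E).
Proof. exact: (dct (@cvgr_idn R)).1. Qed.

Lemma exp_rv_mixture :
  fine (\int[mu]_w (g (x + w))%:E) / g x @[x --> +oo] -->
  fine (\int[mu]_w (expR (- kappa * w))%:E).
Proof.
apply/cvg_pinftyP => u uoo; have [intE cvgE] := dct uoo.
have fin : (\int[mu]_w (expR (- kappa * w))%:E)%E \is a fin_num.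
  exact: integrable_fin_num.
have E n : fine (\int[mu]_w (g (u n + w) / g (u n))%:E)%E =
    fine (\int[mu]_w (g (u n + w))%:E)%E / g (u n).
  under eq_integral do rewrite EFinM.
  rewrite ge0_integralZr//.
  - rewrite fineMr_ge0 ?invr_gt0// integral_ge0// => w _.
    by rewrite lee_fin ltW.
  - by apply/measurable_EFinP; exact: nonincreasing_shift_measurable.
  - by move=> w _; rewrite lee_fin ltW.
  - by rewrite lee_fin invr_ge0 ltW.
rewrite -(eq_cvg _ _ E); apply: fine_cvg; rewrite fineK//.
Qed.
End mixture.

(** Factor f (x + y) / f x through g at both points; the two quotients f / g have
    the same nonzero limit, which cancels. *)
Lemma rv_asymp_transfer (R : realType) (f g : R -> R) (kappa c : R) :
  (forall x, 0 < f x) -> (forall x, 0 < g x) -> 0 < c ->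
  f x / g x @[x --> +oo] --> c ->
  (forall y, g (x + y) / g x @[x --> +oo] --> expR (- kappa * y)) ->
  forall y, f (x + y) / f x @[x --> +oo] --> expR (- kappa * y).
Proof.
move=> f0 g0 c0 fgc g_rv y.
have shift : f (x + y) / g (x + y) @[x --> +oo] --> c.
  apply: (cvg_comp (fun x => x + y) (fun x => f x / g x) _ fgc).
  apply/cvgryPge => A; near=> x.
  by rewrite -lerBlDr; near: x; apply: nbhs_pinfty_ge; rewrite num_real.
have fgV : (f x / g x)^-1 @[x --> +oo] --> c^-1 by apply: cvgV => //; rewrite gt_eqF.
have -> : expR (- kappa * y) = c * expR (- kappa * y) * c^-1.
  by rewrite mulrAC divff ?mul1r// gt_eqF.
have E x : (f (x + y) / g (x + y)) * (g (x + y) / g x) * (f x / g x)^-1 =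
    f (x + y) / f x.
  by field; rewrite !gt_eqF.
under eq_fun do rewrite -E.
by apply: cvgM => //; apply: cvgM => //; exact: g_rv.
Unshelve. all: by end_near. Qed.

Definition rtail (R : realType) (nu : probability R R) (x : R) : R :=
  fine (nu `]x, +oo[%classic).

Section rtail.
Variables (R : realType) (nu : probability R R).

Lemma rtailE x : (rtail nu x)%:E = nu `]x, +oo[%classic.
Proof. by rewrite fineK// fin_num_measure. Qed.

Lemma rtail_nonincreasing : {homo rtail nu : x y /~ x <= y}.
Proof.
move=> x y xy; rewrite -lee_fin !rtailE le_measure ?inE//.
exact: subitvPl.
Qed.

End rtail.

Section difference.
Variables (R : realType) (mu nu : probability R R).

(** Pairs are ordered as (subtrahend, minuend), as in (A, B) and (W, X). *)
Definition diff_gt (x : R) : set (R * R) := [set p | x < p.2 - p.1].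

Lemma measurable_diff : measurable_fun setT (fun p : R * R => p.2 - p.1).
Proof. by apply: measurable_funB; [exact: measurable_snd|exact: measurable_fst]. Qed.

Lemma measurable_diff_gt x : measurable (diff_gt x).
Proof.
rewrite (_ : diff_gt x = (fun p : R * R => p.2 - p.1) @^-1` `]x, +oo[%classic).
  by rewrite -[X in measurable X]setTI; exact: measurable_diff.
by apply/seteqP; split => p; rewrite /diff_gt/= in_itv/= andbT.
Qed.

(** Conditioning on the subtrahend. *)
Lemma product_diff_gt x :
  ((mu \x nu) (diff_gt x) = \int[mu]_w (rtail nu (x + w))%:E)%E.
Proof.
apply: eq_integral => w _; rewrite rtailE /=; congr (nu _).
apply/seteqP; split => u; rewrite /xsection/= inE in_itv/= andbT /diff_gt/=.
  by rewrite ltrBrDr.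
by rewrite ltrBrDr.
Qed.

End difference.

(** * Weak limits and the fixed-point identity *)

Lemma le_limn_einf (R : realType) (u v : (\bar R)^nat) :
  (forall n, u n <= v n)%E -> (limn_einf u <= limn_einf v)%E.
Proof.
move=> uv; rewrite !limn_einf_lim.
apply: lee_lim; [exact: is_cvg_einfs|exact: is_cvg_einfs|].
apply: nearW => n; apply: le_ereal_inf_tmp => _ [k /= nk <-].
by apply: le_trans (uv k); apply: ereal_inf_lbound; exists k.
Qed.

Lemma le_limn_einf_cvg (R : realType) (u v : (\bar R)^nat) (l : \bar R) :
  u n @[n --> \oo] --> l -> (forall n, u n <= v n)%E -> (l <= limn_einf v)%E.
Proof. by move=> /cvg_limn_einf_sup[<- _]; exact: le_limn_einf. Qed.

Lemma itvNyoEbigcup (R : realType) (v : R) :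
  `]-oo, v[%classic = \bigcup_k `]-oo, v - k.+1%:R^-1]%classic.
Proof.
apply/seteqP; split => [y|y [k _]] /=; rewrite !in_itv/=.
  move=> yv; have [k kP] := ltr_add_invr yv; exists k => //=.
  by rewrite in_itv/= lerBrDr ltW.
by move=> /le_lt_trans; apply; rewrite ltrBlDr ltrDl.
Qed.

Lemma cvg_measure_itvNyo (R : realType) (mu : probability R R) (v : R) :
  mu `]-oo, v - n.+1%:R^-1]%classic @[n --> \oo] --> mu `]-oo, v[%classic.
Proof.
rewrite itvNyoEbigcup; apply: nondecreasing_cvg_mu => //.
  exact: bigcup_measurable.
move=> m n mn; apply/subsetPset; apply: subset_itvl.
by rewrite bnd_simp lerD2l lerN2 lef_pV2 ?posrE// ler_nat.
Qed.

Lemma cvg_measure_itvoy (R : realType) (mu : probability R R) (v : R) :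
  mu `]v + n.+1%:R^-1, +oo[%classic @[n --> \oo] --> mu `]v, +oo[%classic.
Proof.
have -> : `]v, +oo[%classic = \bigcup_k `]v + k.+1%:R^-1, +oo[%classic :> set R.
  apply/seteqP; split => [y|y [k _]] /=; rewrite !in_itv/= !andbT.
    by move=> vy; have [k kP] := ltr_add_invr vy; exists k => //=; rewrite in_itv/= andbT.
  by apply: lt_trans; rewrite ltrDl.
apply: nondecreasing_cvg_mu => //; first exact: bigcup_measurable.
move=> m n mn; apply/subsetPset; apply: subset_itvr.
by rewrite bnd_simp lerD2l lef_pV2 ?posrE// ler_nat.
Qed.

Section atomless.
Variables (R : realType) (d : measure_display) (T : measurableType d).
Variables (P : probability T R) (W : {RV P >-> R}).

(** Right continuity holds for every cdf; on the left, the cdf increases to the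
    mass of the open ray, which differs from that of the closed one by the atom. *)
Lemma cdf_continuous_atomless r :
  distribution P W [set r] = 0%E -> {for r, continuous (cdf W)}.
Proof.
move=> Wr0; apply/left_right_continuousP; split; last exact: cdf_right_continuous.
have Fin s : cdf W s \is a fin_num by rewrite fin_num_measure.
have cdf_lt : cdf W r = distribution P W `]-oo, r[%classic.
  rewrite /cdf -(setUitv1 true)// measureU//=; first by rewrite Wr0 adde0.
  by apply/seteqP; split => // x /= [+ xr]; rewrite xr in_itv/= ltxx.
have cvgL : cdf W (r - n.+1%:R^-1) @[n --> \oo] --> cdf W r.
  by rewrite cdf_lt; exact: (@cvg_measure_itvNyo R (distribution P W) r).
rewrite -(fineK (Fin r)); apply/fine_cvgP; split; first by near=> s.
have {}cvgL : fine (cdf W (r - n.+1%:R^-1)) @[n --> \oo] --> fine (cdf W r).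
  by apply: fine_cvg; rewrite fineK.
apply/cvgrPdist_lt => e e0.
move/cvgrPdist_lt : cvgL => /(_ e e0)[n _ /(_ n (leqnn n))] /= He.
near=> s; apply: le_lt_trans He.
have mono a b : a <= b -> fine (cdf W a) <= fine (cdf W b).
  by move=> ab; rewrite fine_le// cdf_nondecreasing.
have sr : s <= r by near: s; exact: nbhs_left_le.
have ns : r - n.+1%:R^-1 <= s by near: s; apply: nbhs_left_ge; rewrite ltrBlDr ltrDl.
rewrite !ger0_norm ?subr_ge0 ?mono// ?lerB// ?mono//.
by rewrite lerBlDr lerDl.
Unshelve. all: by end_near. Qed.

(** Points of positive mass form a countable set, which cannot contain an
    interval of positive length. *)
Lemma cdf_continuity_dense a b : a < b ->
  exists2 r, a < r < b & {for r, continuous (cdf W)}.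
Proof.
move=> ab.
apply: contrapT => noncont.
have pos : `]a, b[%classic `<=` [set r | 0 < pmf W r]%R.
  move=> r /=; rewrite in_itv/= => /andP[ar rb].
  rewrite lt0r pmf_ge0 andbT; apply/eqP => r0; apply: noncont; exists r => //.
    by rewrite ar.
  apply: cdf_continuous_atomless.
  have fin : distribution P W [set r] \is a fin_num by rewrite fin_num_measure.
  by rewrite -(fineK fin); congr EFin.
have := countable_lebesgue_measure0
  (sub_countable (subset_card_le pos) (pmf_gt0_countable W)).
rewrite lebesgue_measure_itv/= lte_fin ab -EFinB => -[] /eqP.
by rewrite subr_eq0 gt_eqF.
Qed.

End atomless.

Section weak_limit.
Variables (R : realType).
Variables (d : measure_display) (T : measurableType d) (P : probability T R).
Variables (d' : measure_display) (T' : measurableType d') (Q : probability T' R).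
Variables (W : {RV P >-> R}) (W_ : nat -> {RV Q >-> R}).
Hypothesis W_W : cvg_in_law W_ W.

(** An open ray is exhausted from inside by rays ending at continuity points of the
    limit cdf, on which the masses converge. *)
Lemma cvg_in_law_lt v :
  (distribution P W `]-oo, v[%classic <=
   limn_einf (fun n => distribution Q (W_ n) `]-oo, v[%classic))%E.
Proof.
have cvgv := @cvg_measure_itvNyo R (distribution P W) v.
rewrite -(cvg_lim _ cvgv)//; apply: lime_le; first exact: cvgP cvgv.
apply: nearW => k.
have [|r /andP[kr rv] /W_W cvgr] := cdf_continuity_dense W (_ : v - k.+1%:R^-1 < v).
  by rewrite ltrBlDr ltrDl.
apply: (@le_trans _ _ (cdf W r)); first exact: cdf_nondecreasing (ltW kr).
apply: le_limn_einf_cvg cvgr _ => n.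
by rewrite le_measure ?inE//; apply: subset_itvl; rewrite bnd_simp.
Qed.

Lemma cvg_in_law_gt v :
  (distribution P W `]v, +oo[%classic <=
   limn_einf (fun n => distribution Q (W_ n) `]v, +oo[%classic))%E.
Proof.
have cvgv := @cvg_measure_itvoy R (distribution P W) v.
rewrite -(cvg_lim _ cvgv)//; apply: lime_le; first exact: cvgP cvgv.
apply: nearW => k.
have [|r /andP[vr rk] /W_W cvgr] := cdf_continuity_dense W (_ : v < v + k.+1%:R^-1).
  by rewrite ltrDl.
apply: (@le_trans _ _ (ccdf W r)); first exact: ccdf_nonincreasing (ltW rk).
have cvgc : ccdf (W_ n) r @[n --> \oo] --> ccdf W r.
  rewrite ccdf_1_cdf; under eq_fun do rewrite ccdf_1_cdf.
  by apply: cvgeB => //; [exact: cvg_cst].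
apply: le_limn_einf_cvg cvgc _ => n.
by rewrite le_measure ?inE//; apply: subset_itvr; rewrite bnd_simp ltW.
Qed.

(** Lower semicontinuity on every section passes to the product by Fatou's lemma. *)
Lemma cvg_in_law_product (nu : probability R R) (C : set (R * R)) :
  measurable C ->
  (forall u, distribution P W (ysection C u) <=
     limn_einf (fun n => distribution Q (W_ n) (ysection C u)))%E ->
  ((distribution P W \x nu) C <=
   limn_einf (fun n => (distribution Q (W_ n) \x nu) C))%E.
Proof.
move=> mC lsc.
have swap (m : probability R R) : ((m \x nu) C = (m \x^ nu) C)%E.
  by apply: product_measure_unique => //= ? ? ? ?; rewrite product_measure2E.
have mW n : measurable_fun setT (fun u => distribution Q (W_ n) (ysection C u)).
  exact: measurable_fun_ysection.
rewrite swap; under eq_fun do rewrite swap.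
apply: le_trans (fatou nu measurableT mW _) => //.
apply: ge0_le_integral => //.
- exact: measurable_fun_ysection.
- apply: measurableT_comp => //; apply: measurable_fun_limn_esup => n.
  exact: measurableT_comp.
- by move=> u _; exact: lsc.
Qed.

Lemma cvg_diff_gt (m : probability (R * R)%type R) (x : R) :
  m (diff_gt (x + n.+1%:R^-1)) @[n --> \oo] --> m (diff_gt x).
Proof.
have -> : diff_gt x = \bigcup_k diff_gt (x + k.+1%:R^-1).
  apply/seteqP; split => [p|p [k _]]; rewrite /diff_gt/=.
    by move=> xp; have [k kP] := ltr_add_invr xp; exists k.
  by apply: lt_trans; rewrite ltrDl.
apply: nondecreasing_cvg_mu => [n||].
- exact: measurable_diff_gt.
- by apply: bigcup_measurable => n _; exact: measurable_diff_gt.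
move=> a b ab; apply/subsetPset => p; rewrite /diff_gt/=; apply: le_lt_trans.
by rewrite lerD2l lef_pV2 ?posrE// ler_nat.
Qed.

Variable nu : probability R R.
Hypothesis W_ge0 : forall n t, 0 <= W_ n t.
Hypothesis W_rec : forall n (x : R), 0 <= x ->
  (ccdf (W_ n.+1) x = (distribution Q (W_ n) \x nu) (diff_gt x))%E.

Local Notation mu := (distribution P W).
Local Notation mu_ n := (distribution Q (W_ n)).

(** Lower semicontinuity on the open ray of negative numbers, which has mass zero
    at every stage. *)
Lemma limit_law_ge0 : mu `]-oo, 0[%classic = 0%E.
Proof.
apply/eqP; rewrite eq_le measure_ge0 andbT.
apply: le_trans (cvg_in_law_lt 0) _.
rewrite (_ : (fun n => _) = cst 0%E); first by rewrite (cvg_limn_einf_sup (cvg_cst _)).1.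
apply/funext => n /=; rewrite /distribution /pushforward.
rewrite (_ : _ @^-1` _ = set0) ?measure0//.
by apply/seteqP; split => // t /=; rewrite in_itv/= ltNge W_ge0.
Qed.

Let cvg_ccdf (r : R) : {for r, continuous (cdf W)} ->
  ccdf (W_ n.+1) r @[n --> \oo] --> ccdf W r.
Proof.
move=> /W_W cvgr; rewrite ccdf_1_cdf; under eq_fun do rewrite ccdf_1_cdf.
apply: cvgeB => //; first exact: cvg_cst.
by rewrite (@cvg_shiftS _ (fun n => cdf (W_ n) r)).
Qed.

(** The sections of the half-plane are open rays to the left. *)
Let limit_lower (r : R) : 0 <= r -> {for r, continuous (cdf W)} ->
  ((mu \x nu) (diff_gt r) <= ccdf W r)%E.
Proof.
move=> r0 rc.
rewrite -(cvg_limn_einf_sup (cvg_ccdf rc)).1.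
under eq_fun do rewrite W_rec//.
apply: cvg_in_law_product => [|u]; first exact: measurable_diff_gt.
rewrite (_ : ysection _ u = `]-oo, u - r[%classic); first exact: cvg_in_law_lt.
by apply/seteqP; split => w; rewrite /ysection/= inE in_itv/= /diff_gt/= ltrBrDl ltrBrDr.
Qed.

(** The complementary half-plane u - w < r is open as well, and lower
    semicontinuity there bounds the cdf of the limit from below. *)
Let limit_upper (r : R) : 0 <= r -> {for r, continuous (cdf W)} ->
  (ccdf W r <= (mu \x nu) [set p : R * R | (r <= p.2 - p.1)%R])%E.
Proof.
move=> r0 rc.
pose C : set (R * R) := [set p | p.2 - p.1 < r].
have mC : measurable C.
  rewrite (_ : C = (fun p : R * R => p.2 - p.1) @^-1` `]-oo, r[%classic).
    by rewrite -[X in measurable X]setTI; exact: measurable_diff.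
  by apply/seteqP; split => p; rewrite /C/= in_itv.
have -> : [set p : R * R | r <= p.2 - p.1] = ~` C.
  by apply/seteqP; split => p; rewrite /C/= leNgt => /negP.
rewrite probability_setC// ccdf_1_cdf; apply: leeB => //.
have := rc => /W_W; rewrite -(@cvg_shiftS _ (fun n => cdf (W_ n) r)).
move=> /cvg_limn_einf_sup[<- _].
apply: (@le_trans _ _ (limn_einf (fun n => (mu_ n \x nu)%E C))).
  apply: cvg_in_law_product => // u.
  rewrite (_ : ysection _ u = `]u - r, +oo[%classic); first exact: cvg_in_law_gt.
  by apply/seteqP; split => w; rewrite /ysection/= inE in_itv/= /C/= andbT ltrBlDl ltrBlDr.
apply: le_limn_einf => n /=.
rewrite cdf_1_ccdf W_rec// -probability_setC; last exact: measurable_diff_gt.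
apply: le_measure; rewrite ?inE//; first by apply: measurableC; exact: measurable_diff_gt.
by move=> p; rewrite /C /diff_gt/= => /ltW; rewrite leNgt => /negP.
Qed.

(** The bounds at continuity points r differ by the mass of the line u - w = r.
    Letting r decrease to x closes this gap: the closed half-plane at r > x lies in
    the open half-plane at x. *)
Lemma limit_law_fixpoint (x : R) : 0 <= x ->
  (mu `]x, +oo[%classic = (mu \x nu) (diff_gt x))%E.
Proof.
move=> x0; apply/eqP; rewrite eq_le; apply/andP; split.
- have cvgx := @cvg_measure_itvoy R mu x.
  rewrite -(cvg_lim _ cvgx)//; apply: lime_le; first exact: cvgP cvgx.
  apply: nearW => k.
  have [|r /andP[xr rk] rc] := cdf_continuity_dense W (_ : x < x + k.+1%:R^-1).
    by rewrite ltrDl.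
  apply: (@le_trans _ _ (ccdf W r)); first exact: ccdf_nonincreasing (ltW rk).
  apply: le_trans (limit_upper (le_trans x0 (ltW xr)) rc) _.
  apply: le_measure; rewrite ?inE.
  + rewrite (_ : mkset _ = (fun p : R * R => p.2 - p.1) @^-1` `[r, +oo[%classic).
      by rewrite -[X in measurable X]setTI; exact: measurable_diff.
    by apply/seteqP; split => p; rewrite /= in_itv/= andbT.
  + exact: measurable_diff_gt.
  + by move=> p; rewrite /diff_gt/=; exact: lt_le_trans.
- have cvgx := @cvg_diff_gt (mu \x nu)%E x.
  rewrite -(cvg_lim _ cvgx)//; apply: lime_le; first exact: cvgP cvgx.
  apply: nearW => k.
  have [|r /andP[xr rk] rc] := cdf_continuity_dense W (_ : x < x + k.+1%:R^-1).
    by rewrite ltrDl.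
  apply: (@le_trans _ _ ((mu \x nu) (diff_gt r))%E).
    apply: le_measure; rewrite ?inE; [exact: measurable_diff_gt..|].
    by move=> p; rewrite /diff_gt/=; apply: lt_trans.
  apply: le_trans (limit_lower (le_trans x0 (ltW xr)) rc) _.
  exact: ccdf_nonincreasing (ltW xr).
Qed.

End weak_limit.

(** * Independence *)

(** For fixed H, both V |-> Q (V `&` H) and V |-> Q V * Q H are finite measures, so
    agreement on a pi-system extends to the sigma-algebra that it generates. *)
Lemma prob_indep_extend (R : realType) (d : measure_display)
    (T : measurableType d) (Q : probability T R) (G : set_system T) (H : set T) :
  G `<=` measurable -> setI_closed G -> G setT -> measurable H ->
  (forall V, G V -> Q (V `&` H) = (Q V * Q H)%E) ->
  forall V, <<s G >> V -> Q (V `&` H) = (Q V * Q H)%E.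
Proof.
move=> Gm GI GT mH indep V sV.
have finH : Q H \is a fin_num by rewrite fin_num_measure.
have QH0 : 0 <= fine (Q H) by rewrite fine_ge0.
have := @g_sigma_algebra_measure_unique _ R T G Gm (fun=> setT) (fun=> GT) _
  (mrestr Q mH) (mscale (NngNum QH0) Q) GI _ _ V sV.
rewrite /= /mrestr /mscale /= fineK// muleC; apply => //.
- by rewrite bigcup_const.
- by move=> A GA; rewrite indep// muleC.
- by move=> _; rewrite setTI ltey_eq finH.
Qed.

(** The pi-systems are replaced by their generated sigma-algebras one index at a
    time. *)
Lemma indep_sigma_algebras (R : realType) (d : measure_display)
    (T : measurableType d) (Q : probability T R) (G : nat -> set_system T)
    (N : nat) :
  (forall m, G m `<=` measurable) -> (forall m, setI_closed (G m)) ->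
  (forall m, G m setT) ->
  (forall Z : nat -> set T, (forall m, (m < N)%N -> G m (Z m)) ->
    Q (\big[setI/setT]_(m < N) Z m) = (\prod_(m < N) Q (Z m))%E) ->
  forall Z : nat -> set T, (forall m, (m < N)%N -> <<s G m >> (Z m)) ->
    Q (\big[setI/setT]_(m < N) Z m) = (\prod_(m < N) Q (Z m))%E.
Proof.
move=> Gm GI GT indep.
(* Indices below k already range over the generated sigma-algebras. *)
suff claim k Z : (forall m, (m < N)%N ->
      if (m < k)%N then <<s G m >> (Z m) else G m (Z m)) ->
    Q (\big[setI/setT]_(m < N) Z m) = (\prod_(m < N) Q (Z m))%E.
  by move=> Z sZ; apply: (claim N) => m mN; rewrite mN; exact: sZ.
elim: k => [|k IH] in Z *; first by move=> GZ; apply: indep => m /GZ.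
move=> GZ; have [kN|Nk] := ltnP k N; last first.
  apply: IH => m mN; have := GZ m mN.
  by rewrite (leq_trans mN Nk) (leq_trans mN (leq_trans Nk _)).
pose Zk V m := if m == k then V else Z m.
pose H := \big[setI/setT]_(m < N | m != Ordinal kN) Z m.
have sm m : (m < N)%N -> measurable (Z m).
  move=> /GZ; case: ifP => _; last exact: Gm.
  by apply: smallest_sub; [exact: sigma_algebra_measurable|exact: Gm].
have split V : Q (V `&` H) = Q (\big[setI/setT]_(m < N) Zk V m).
  rewrite [in RHS](bigD1 (Ordinal kN))//= {1}/Zk eqxx; congr (Q (_ `&` _)).
  apply: eq_bigr => m mk; rewrite /Zk -(inj_eq val_inj) /= in mk *.
  by rewrite (negbTE mk).
have splitp V : (\prod_(m < N) Q (Zk V m) = Q V * \prod_(m < N | m != Ordinal kN) Q (Z m))%E.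
  rewrite (bigD1 (Ordinal kN))//= {1}/Zk eqxx; congr (_ * _)%E.
  apply: eq_bigr => m mk; rewrite /Zk -(inj_eq val_inj) /= in mk *.
  by rewrite (negbTE mk).
have GV V : G k V -> Q (V `&` H) = (Q V * \prod_(m < N | m != Ordinal kN) Q (Z m))%E.
  move=> GkV; rewrite split IH ?splitp// => m mN; rewrite /Zk.
  case: eqVneq => [->|mk]; first by rewrite ltnn.
  by have := GZ m mN; rewrite ltnS leq_eqVlt (negbTE mk).
have QH : Q H = (\prod_(m < N | m != Ordinal kN) Q (Z m))%E.
  by rewrite -[H]setTI GV// probability_setT mul1e.
rewrite (bigD1 (Ordinal kN))//= -/H [RHS](bigD1 (Ordinal kN))//= -QH.
apply: (@prob_indep_extend _ _ _ _ (G k)) => //.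
- by apply: bigsetI_measurable => m _; exact: sm.
- by move=> V GkV; rewrite GV// QH.
- by have := GZ k kN; rewrite ltnSn.
Qed.

Section pairs.
Variables (R : realType) (d : measure_display) (T : measurableType d).
Variable (Q : probability T R).

(** The pi-system generating the joint sigma-algebra of u and v. *)
Definition rectangles (u v : T -> R) : set_system T :=
  [set u @^-1` E `&` v @^-1` F | E in measurable & F in measurable].

Lemma rectangles_measurable (u v : T -> R) :
  measurable_fun setT u -> measurable_fun setT v ->
  rectangles u v `<=` measurable.
Proof.
move=> mu mv _ [E mE [F mF <-]]; apply: measurableI; rewrite -[X in measurable X]setTI.
  exact: mu.
exact: mv.
Qed.

Lemma rectangles_setI (u v : T -> R) : setI_closed (rectangles u v).
Proof.
move=> _ _ [E mE [F mF <-]] [E' mE' [F' mF' <-]].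
exists (E `&` E'); first exact: measurableI.
exists (F `&` F'); first exact: measurableI.
by rewrite !preimage_setI setIACA.
Qed.

Lemma rectangles_setT (u v : T -> R) : rectangles u v setT.
Proof. by exists setT => //; exists setT => //; rewrite !preimage_setT setTI. Qed.

Lemma sigma_rectangles_preimage (u v : T -> R) (f : R * R -> R) (D : set R) :
  measurable_fun setT f -> measurable D ->
  <<s rectangles u v >> ((fun t => f (u t, v t)) @^-1` D).
Proof.
move=> mf mD.
pose G := rectangles u v.
have mu : measurable_fun setT (u : g_sigma_algebraType G -> R).
  move=> _ E mE; rewrite setTI; apply: sub_sigma_algebra.
  by exists E => //; exists setT => //; rewrite preimage_setT setIT.
have mv : measurable_fun setT (v : g_sigma_algebraType G -> R).
  move=> _ E mE; rewrite setTI; apply: sub_sigma_algebra.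
  by exists setT => //; exists E => //; rewrite preimage_setT setTI.
have mfuv : measurable_fun setT
    ((fun t => f (u t, v t)) : g_sigma_algebraType G -> R).
  exact: (measurableT_comp mf (measurable_fun_pair mu mv)).
by rewrite -[X in <<s _ >> X]setTI; exact: mfuv.
Qed.

(** A probability on the plane is determined by its values on rectangles. *)
Lemma product_law (u v : {RV Q >-> R}) (m1 m2 : probability R R) :
  (forall E F, measurable E -> measurable F ->
    Q (u @^-1` E `&` v @^-1` F) = m1 E * m2 F)%E ->
  forall C : set (R * R), measurable C ->
    Q ((fun t => (u t, v t)) @^-1` C) = (m1 \x m2)%E C.
Proof.
move=> rect C mC.
have muv : measurable_fun setT (fun t => (u t, v t)) by exact: measurable_fun_pair.
pose uv : {mfun T >-> (R * R)%type} := mfun_Sub (mem_set muv).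
have := @product_measure_unique _ _ _ _ _ m1 m2 (distribution Q uv) _ C mC.
by move=> ->// E F mE mF; rewrite -rect.
Qed.

(** The product rule over a duplicate-free list, which is easier to split than one
    over a finite set. *)
Lemma mutually_independent_seq (I : choiceType) (Y : I -> {RV Q >-> R})
    (D : I -> set R) (s : seq I) :
  mutually_independent Y -> uniq s -> (forall i, measurable (D i)) ->
  Q (\big[setI/setT]_(i <- s) (Y i @^-1` D i)) =
  (\prod_(i <- s) Q (Y i @^-1` D i))%E.
Proof.
move=> indep us mD.
have := indep [fset i in s]%fset D (fun i _ => mD i).
have ps : perm_eq [fset i in s]%fset s.
  by apply: uniq_perm => // i; rewrite in_fset.
rewrite bigcap_fset !(perm_big _ ps)//.
Qed.
End pairs.

Lemma independent_rv_preimage (R : realType) (d : measure_display)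
    (T : measurableType d) (P : probability T R) (Y Z : {RV P >-> R})
    (E F : set R) :
  independent_rv Y Z -> measurable E -> measurable F ->
  P (Y @^-1` E `&` Z @^-1` F) = (P (Y @^-1` E) * P (Z @^-1` F))%E.
Proof.
move=> indep mE mF; apply: indep; apply: sub_sigma_algebra; exists tt => //.
  by exists E => //; rewrite setTI.
by exists F => //; rewrite setTI.
Qed.

Section recursion.
Variables (R : realType) (d : measure_display) (T : measurableType d).
Variables (Q : probability T R) (A B W : nat -> {RV Q >-> R}).
Hypothesis AB_indep : mutually_independent (join_seq A B).

Local Notation X := (fun n => sub_rv (B n.+1) (A n)).

Lemma block_indep (E F : nat -> set R) (N : nat) :
  (forall m, measurable (E m)) -> (forall m, measurable (F m)) ->
  Q (\big[setI/setT]_(m < N) (A m @^-1` E m `&` B m.+1 @^-1` F m)) =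
  (\prod_(m < N) (Q (A m @^-1` E m) * Q (B m.+1 @^-1` F m)))%E.
Proof.
move=> mE mF.
(* Block m takes its second input from place m.+1, hence the predecessor. *)
pose D (i : nat + nat) := match i with inl m => E m | inr m => F m.-1 end.
pose s : seq (nat + nat) :=
  [seq inl m | m <- index_iota 0 N] ++ [seq inr m.+1 | m <- index_iota 0 N].
have us : uniq s.
  rewrite cat_uniq !map_inj_uniq ?(iota_uniq 0 (N - 0))//= ?andbT.
  - by apply/hasPn => _ /mapP[m _ ->]; apply/mapP => -[].
  - by move=> m n [].
  - by move=> m n [].
have mD i : measurable (D i) by case: i => m; [exact: mE|exact: mF].
have := mutually_independent_seq AB_indep us mD.
by rewrite !big_cat/= !big_map/= -!big_split/= !big_mkord.
Qed.

Lemma block_pair_indep (E F : set R) (n : nat) :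
  measurable E -> measurable F ->
  Q (A n @^-1` E `&` B n.+1 @^-1` F) =
  (Q (A n @^-1` E) * Q (B n.+1 @^-1` F))%E.
Proof.
move=> mE mF.
pose D (i : nat + nat) := match i with inl _ => E | inr _ => F end.
have mD i : measurable (D i) by case: i.
have := mutually_independent_seq AB_indep (_ : uniq [:: inl n; inr n.+1]) mD.
by rewrite !big_cons !big_nil/= setIT mule1; exact.
Qed.

(** The m-th increment depends only on the block (A m, B m.+1), and distinct blocks
    share no variable. *)
Lemma increments_indep (D : nat -> set R) (N : nat) :
  (forall m, measurable (D m)) ->
  Q (\big[setI/setT]_(m < N) (X m @^-1` D m)) =
  (\prod_(m < N) Q (X m @^-1` D m))%E.
Proof.
move=> mD.
apply: (@indep_sigma_algebras _ _ _ _ (fun m => rectangles (A m) (B m.+1)) _ _ _ _ _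
  (fun m => X m @^-1` D m)).
- by move=> m; exact: rectangles_measurable.
- by move=> m; exact: rectangles_setI.
- by move=> m; exact: rectangles_setT.
- move=> Z ZG.
  have /choice[EF EFP] : forall m, exists EF : set R * set R,
      [/\ measurable EF.1, measurable EF.2 &
        (m < N)%N -> Z m = A m @^-1` EF.1 `&` B m.+1 @^-1` EF.2].
    move=> m; have [/ZG[E mE [F mF <-]]|_] := ltnP m N; first by exists (E, F).
    by exists (setT, setT); split=> /=; [exact: measurableT|exact: measurableT|].
  have ZE (m : 'I_N) : Z m = A m @^-1` (EF m).1 `&` B m.+1 @^-1` (EF m).2.
    by have [_ _ ->] := EFP m.
  under eq_bigr do rewrite ZE.
  under [RHS]eq_bigr do rewrite ZE.
  rewrite (@block_indep (fun m => (EF m).1) (fun m => (EF m).2)); last 2 first.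
  - by move=> m; have [] := EFP m.
  - by move=> m; have [] := EFP m.
  by apply: eq_bigr => m _; rewrite block_pair_indep//; have [] := EFP m.
- move=> m _.
  apply: (@sigma_rectangles_preimage _ _ _ (A m) (B m.+1) (fun p => p.2 - p.1)) => //.
  exact: measurable_diff.
Qed.

Hypothesis W0_indep : independent_of_family (W 0%N) X.
Hypothesis W_rec : forall n t, W n.+1 t = Num.max 0 (X n t - W n t).

Let last_increment (n : nat) (G : set R) :
  \big[setI/setT]_(m < n.+1) (X m @^-1` (if m == n :> nat then G else setT)) =
  X n @^-1` G.
Proof.
rewrite big_ord_recr/= eqxx big1 ?setTI// => m _.
by rewrite ltn_eqF// preimage_setT.
Qed.

(** A vector of increments of indices below N is written with the whole line in the
    places below n, so that all vectors have the same length.  In the inductive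
    step, W n.+1 is a function of W n and X n; rectangles in this pair are
    independent of the later increments because the previous stage covers X n
    together with them. *)
Lemma state_indep_future (n N : nat) (E : set R) (D : nat -> set R) :
  (n < N)%N -> measurable E -> (forall m, measurable (D m)) ->
  (forall m, (m < n)%N -> D m = setT) ->
  Q (W n @^-1` E `&` \big[setI/setT]_(m < N) (X m @^-1` D m)) =
  (Q (W n @^-1` E) * Q (\big[setI/setT]_(m < N) (X m @^-1` D m)))%E.
Proof.
elim: n => [|n IH] in N E D *.
  move=> _ mE mD _; apply: W0_indep.
    by apply: sub_sigma_algebra; exists tt => //; exists E => //; rewrite setTI.
  apply: (@bigsetI_measurable _ (g_sigma_algebraType
    (\bigcup_i preimage_set_system setT (X i) measurable))) => m _.
  by apply: sub_sigma_algebra; exists (m : nat) => //; exists (D m) => //; rewrite setTI.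
move=> nN mE mD DT.
have {}nN : (n < N)%N by exact: ltn_trans nN.
pose H := \big[setI/setT]_(m < N) (X m @^-1` D m).
rewrite -/H.
have mH : measurable H by apply: bigsetI_measurable => m _; exact: measurable_funPTI.
have HE : H = \big[setI/setT]_(m < N | m != Ordinal nN) (X m @^-1` D m).
  by rewrite /H (bigD1 (Ordinal nN))//= DT// preimage_setT setTI.
(* The vector D with the free place n constrained to F. *)
pose Dn F m := if m == n then F else D m.
have mDn F m : measurable F -> measurable (Dn F m).
  by move=> mF; rewrite /Dn; case: ifP.
have DnT F m : (m < n)%N -> Dn F m = setT.
  by move=> mn; rewrite /Dn ltn_eqF// DT// ltnS ltnW.
have Dn_split F : \big[setI/setT]_(m < N) (X m @^-1` Dn F m) = X n @^-1` F `&` H.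
  rewrite (bigD1 (Ordinal nN))//= {1}/Dn eqxx HE; congr (_ `&` _).
  apply: eq_bigr => m mn; rewrite /Dn -(inj_eq val_inj) /= in mn *.
  by rewrite (negbTE mn).
have XH F : measurable F -> Q (X n @^-1` F `&` H) = (Q (X n @^-1` F) * Q H)%E.
  move=> mF; rewrite -Dn_split increments_indep; last by move=> m; exact: mDn.
  rewrite (bigD1 (Ordinal nN))//= {1}/Dn eqxx; congr (_ * _)%E.
  rewrite /H increments_indep// [RHS](bigD1 (Ordinal nN))//= DT//.
  rewrite preimage_setT probability_setT mul1e.
  apply: eq_bigr => m mn; rewrite /Dn -(inj_eq val_inj) /= in mn *.
  by rewrite (negbTE mn).
have WXH F G : measurable F -> measurable G ->
    Q (W n @^-1` F `&` (X n @^-1` G `&` H)) =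
    (Q (W n @^-1` F) * Q (X n @^-1` G `&` H))%E.
  move=> mF mG; rewrite -Dn_split; apply: IH => // [m|m]; first exact: mDn.
  exact: DnT.
have WX F G : measurable F -> measurable G ->
    Q (W n @^-1` F `&` X n @^-1` G) = (Q (W n @^-1` F) * Q (X n @^-1` G))%E.
  move=> mF mG; rewrite -(last_increment n G).
  apply: (IH n.+1 F (fun m => if m == n then G else setT)) => //.
  - by move=> m; case: ifP.
  - by move=> m mn; rewrite ltn_eqF.
have WE : W n.+1 @^-1` E = (fun t => Num.max 0 (X n t - W n t)) @^-1` E.
  by apply/seteqP; split => t /=; rewrite W_rec.
rewrite WE.
apply: (@prob_indep_extend _ _ _ _ (rectangles (W n) (X n))) => //.
- exact: rectangles_measurable.
- exact: rectangles_setI.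
- exact: rectangles_setT.
- move=> _ [F mF [G mG <-]].
  by rewrite -setIA WXH// XH// WX// muleA.
- apply: (@sigma_rectangles_preimage _ _ _ (W n) (X n)
    (fun p => Num.max 0 (p.2 - p.1))) => //.
  by apply: measurable_maxr => //; exact: measurable_diff.
Qed.

Lemma state_indep_increment (n : nat) (E F : set R) :
  measurable E -> measurable F ->
  Q (W n @^-1` E `&` X n @^-1` F) = (Q (W n @^-1` E) * Q (X n @^-1` F))%E.
Proof.
move=> mE mF; rewrite -(last_increment n F).
apply: (@state_indep_future n n.+1 E (fun m => if m == n then F else setT)) => //.
- by move=> m; case: ifP.
- by move=> m mn; rewrite ltn_eqF.
Qed.
End recursion.

(** * The tail of the steady state *)

(** By independence the pair (A, B) has the product of the two laws, and D is pulled
    back along the difference. *)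
Lemma sub_rv_law (R : realType) (d : measure_display) (T : measurableType d)
    (P : probability T R) (A B : {RV P >-> R}) (D : set R) :
  independent_rv A B -> measurable D ->
  P (sub_rv B A @^-1` D) =
  (distribution P A \x distribution P B)%E [set p | D (p.2 - p.1)].
Proof.
move=> indep mD; rewrite -(@product_law _ _ _ P A B)//.
  by move=> E F mE mF; exact: independent_rv_preimage.
by rewrite -[X in measurable X]setTI; exact: measurable_diff.
Qed.

Lemma integral_expR_gt0 (R : realType) (mu : probability R R) (kappa : R) :
  mu.-integrable setT (fun w => (expR (- kappa * w))%:E) ->
  0 < fine (\int[mu]_w (expR (- kappa * w))%:E)%E.
Proof.
move=> int_e; rewrite -lte_fin fineK; last exact: integrable_fin_num.
apply: prob_integral_gt0; last by move=> w; exact: expR_gt0.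
exact: (measurableT_comp (@measurable_expR R) (@mulrl_measurable _ _ _)).
Qed.

Theorem proposition2 (R : realType)
  (d : measure_display) (T : measurableType d) (P : probability T R)
  (A B W : {RV P >-> R})
  (d' : measure_display) (T' : measurableType d') (Q : probability T' R)
  (A_ B_ W_ : nat -> {RV Q >-> R})
  (kappa : R)
  (A_ge0 : forall t, 0 <= A t) (B_ge0 : forall t, 0 <= B t)
  (AB_indep : independent_rv A B)
  (X_lt0 : (0 < P [set t | (sub_rv B A t < 0)%R])%E)
  (An_ge0 : forall n t, 0 <= A_ n t) (Bn_ge0 : forall n t, 0 <= B_ n t)
  (An_law : forall n, same_law (A_ n) A)
  (Bn_law : forall n, same_law (B_ n) B)
  (AnBn_indep : mutually_independent (join_seq A_ B_))
  (W0_ge0 : forall t, 0 <= W_ 0%N t)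
  (W0_indep : independent_of_family (W_ 0%N)
                (fun n => sub_rv (B_ n.+1) (A_ n)))
  (W_rec : forall n t,
     W_ n.+1 t = Num.max 0 (sub_rv (B_ n.+1) (A_ n) t - W_ n t))
  (W_limit : cvg_in_law W_ W)
  (kappa_ge0 : 0 <= kappa)
  (B_rv : exp_regularly_varying B kappa) :
  asymp_equiv (tail W)
    (fun x => tail (sub_rv B A) x
              * fine ('E_P[fun t => expR (- kappa * W t)])%E).
Proof.
pose X n := sub_rv (B_ n.+1) (A_ n).
pose nu : probability R R := distribution P (sub_rv B A).
pose mu : probability R R := distribution P W.
have X_law n D : measurable D -> Q (X n @^-1` D) = nu D.
  move=> mD; rewrite [RHS](sub_rv_law AB_indep mD).
  rewrite -(@product_law _ _ _ Q (A_ n) (B_ n.+1)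
    (distribution P A) (distribution P B))//.
    move=> E F mE mF; rewrite (block_pair_indep AnBn_indep)//.
    by congr (_ * _)%E; [exact: An_law|exact: Bn_law].
  by rewrite -[Y in measurable Y]setTI; exact: measurable_diff.
(* The maximum with 0 is invisible above a level x >= 0. *)
have step n (x : R) : 0 <= x ->
    ccdf (W_ n.+1) x = (distribution Q (W_ n) \x nu)%E (diff_gt x).
  move=> x0; rewrite -(@product_law _ _ _ Q (W_ n) (X n)).
  - rewrite /ccdf /distribution /pushforward; congr (Q _).
    apply/seteqP; split => t; rewrite /diff_gt/= in_itv/= andbT W_rec lt_max ltNge x0//=.
  - move=> E F mE mF.
    rewrite (state_indep_increment AnBn_indep W0_indep W_rec)//; congr (_ * _)%E.
    exact: X_law.
  - exact: measurable_diff_gt.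
have W_ge0 n t : 0 <= W_ n t by case: n => [//|n]; rewrite W_rec le_max lexx.
have mu0 : mu `]-oo, 0[%classic = 0%E := limit_law_ge0 W_limit W_ge0.
have A0 : distribution P A `]-oo, 0[%classic = 0%E.
  rewrite /distribution /pushforward (_ : _ @^-1` _ = set0) ?measure0//.
  by apply/seteqP; split => // t /=; rewrite in_itv/= ltNge A_ge0.
have [B_gt0 B_ratio] := B_rv.
have B_dec : {homo tail B : x y /~ x <= y} := @rtail_nonincreasing R (distribution P B).
have X_dec : {homo tail (sub_rv B A) : x y /~ x <= y} := @rtail_nonincreasing R nu.
have XE x : ((tail (sub_rv B A) x)%:E = \int[distribution P A]_w (tail B (x + w))%:E)%E.
  rewrite -[RHS](@product_diff_gt R (distribution P A) (distribution P B)).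
  rewrite (@rtailE R nu) [LHS](sub_rv_law AB_indep)//; congr (_ _).
  by apply/seteqP; split => p; rewrite /diff_gt/= in_itv/= andbT.
have X_gt0 x : 0 < tail (sub_rv B A) x.
  rewrite -lte_fin XE; apply: prob_integral_gt0 => // .
  exact: nonincreasing_shift_measurable.
(* First use of the mixture: B observed at the random level x + A. *)
have X_B := exp_rv_mixture B_dec B_gt0 B_ratio A0.
have cA_gt0 := integral_expR_gt0 (integrable_expR_mixture B_dec B_gt0 B_ratio A0).
have X_ratio : forall y, tail (sub_rv B A) (x + y) / tail (sub_rv B A) x
    @[x --> +oo] --> expR (- kappa * y).
  apply: (rv_asymp_transfer X_gt0 B_gt0 cA_gt0) => //.
  by under eq_fun do rewrite -[tail (sub_rv B A) _]/(fine (tail (sub_rv B A) _)%:E) XE.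
(* Second use: X observed at the random level x + W. *)
have W_X := exp_rv_mixture X_dec X_gt0 X_ratio mu0.
have cW_gt0 := integral_expR_gt0 (integrable_expR_mixture X_dec X_gt0 X_ratio mu0).
set cW := fine _ in W_X cW_gt0.
have -> : fine ('E_P[fun t => expR (- kappa * W t)])%E = cW.
  rewrite unlock /cW ge0_integral_distribution//.
  apply/measurable_EFinP.
  exact: (measurableT_comp (@measurable_expR R) (@mulrl_measurable _ _ _)).
rewrite /asymp_equiv.
have -> : 1 = cW / cW by rewrite divff// gt_eqF.
have : fine (\int[mu]_w (tail (sub_rv B A) (x + w))%:E) /
    tail (sub_rv B A) x / cW @[x --> +oo] --> cW / cW.
  by apply: cvgM => //; exact: cvg_cst.
apply: cvg_trans; apply: near_eq_cvg; near=> x.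
have x0 : 0 <= x by near: x; apply: nbhs_pinfty_ge; rewrite num_real.
rewrite invfM mulrA; congr (_ / _ / _).
rewrite -(@product_diff_gt R mu nu) -(limit_law_fixpoint W_limit step x0).
by [].
Unshelve. all: by end_near. Qed.
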